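(* Let $X$ be a hereditarily locally connected continuum and let $f:X\to X$ be a homeomorphism. Then the map $\omega_f:X\to 2^X$, $x\mapsto\omega_f(x)$, is continuous on $X\setminus\Omega(f)$.
   Context: A continuum is a nonempty connected compact metric space; it is hereditarily locally connected if each of its subcontinua is locally connected. $2^X$ denotes the hyperspace of all nonempty closed subsets of $X$, endowed with the Hausdorff metric $d_H(A,B)=\max\{\sup_{x\in A}d(x,B),\sup_{y\in B}d(y,A)\}$. The $\omega$-limit set of $x$ is $\omega_f(x)=\{y\in X:\exists\, n_i\in\mathbb{N},\ n_i\to\infty,\ \lim_{i\to\infty}d(f^{n_i}(x),y)=0\}$; it is nonempty and closed. A point $x$ is wandering for $f$ if there is a neighborhood $U$ of $x$ with $f^{-n}(U)\cap U=\emptyset$ for every integer $n\ge 1$; otherwise $x$ is non-wandering, and $\Omega(f)$ is the set of non-wandering points. *)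

(* Defs.v *)
From HB Require Import structures.
From mathcomp Require Import all_boot all_order all_algebra.
From mathcomp Require Import all_classical all_reals all_analysis.

Set Implicit Arguments.
Unset Strict Implicit.
Unset Printing Implicit Defensive.

Import Order.TTheory GRing.Theory Num.Theory.
Import numFieldNormedType.Exports.

Local Open Scope classical_set_scope.
Local Open Scope ring_scope.

Definition continuum (R : realType) (X : metricType R) (A : set X) : Prop :=
  [/\ A !=set0, connected A & compact A].

HB.mixin Record Metric_isContinuum (R : realType) X & Metric R X := {
  continuumT : continuum [set: X]
}.

#[short(type="continuumType")]
HB.structure Definition Continuum (R : realType) :=
  { X of Metric R X & Metric_isContinuum R X }.

(* Local connectedness of [A] in its subspace topology, whose open sets are
   the [V `&` A] with [V] open: every point of [A] has a base of connected open
   neighbourhoods. *)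
Definition locally_connected (T : topologicalType) (A : set T) : Prop :=
  forall (x : T) (U : set T), A x -> open U -> U x ->
    exists V : set T,
      [/\ open V, V x, V `&` A `<=` U & connected (V `&` A)].

Definition hereditarily_locally_connected (R : realType) (X : continuumType R)
    : Prop :=
  forall A : set X, continuum A -> locally_connected A.

Definition homeomorphism (T U : topologicalType) (f : T -> U) : Prop :=
  continuous f /\
  exists g : U -> T, [/\ cancel f g, cancel g f & continuous g].

Section dynamics.
Context {R : realType} {X : metricType R}.
Implicit Types (f : X -> X) (x y : X).

Definition omega_limit f x : set X :=
  [set y | exists n : nat -> nat,
    n i @[i --> \oo] --> \oo /\
    mdist (iter (n i) f x) y @[i --> \oo] --> (0 : R)].

Definition wandering f x : Prop :=
  exists2 U : set X, nbhs x U &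
    forall n : nat, (1 <= n)%N -> (iter n f @^-1` U) `&` U = set0.

Definition nonwandering_set f : set X := [set x | ~ wandering f x].

End dynamics.

Section hausdorff_dist.
Context {R : realType} {X : metricType R}.
Implicit Types (A B C : set X) (x y : X).

Definition dist_set x A : R := inf [set mdist x y | y in A].

(* The suprema are genuine when [A] and [B] are nonempty and bounded, which is
   the only case used below. *)
Definition hausdorff_dist A B : R :=
  Num.max (sup [set dist_set x B | x in A]) (sup [set dist_set y A | y in B]).

Lemma dist_set_ge0 x A : 0 <= dist_set x A.
Proof.
have [->|/set0P A0] := eqVneq A set0; first by rewrite /dist_set image_set0 inf0.
case: A0 => a Aa; apply: lb_le_inf; first by exists (mdist x a); exists a.
by move=> _ [y _ <-]; exact: mdist_ge0.
Qed.

Lemma dist_set_le x y A : A y -> dist_set x A <= mdist x y.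
Proof.
move=> Ay; apply: ge_inf; last by exists y.
by exists 0 => _ [z _ <-]; exact: mdist_ge0.
Qed.

Lemma dist_set_lt x A (e : R) : A !=set0 -> dist_set x A < e ->
  exists2 y, A y & mdist x y < e.
Proof.
move=> [a Aa] h.
have [] := @inf_lt _ [set mdist x y | y in A] e _ h.
  by exists (mdist x a); exists a.
by move=> _ [y Ay <-] ?; exists y.
Qed.

Lemma dist_set_eq0 x A : closed A -> A !=set0 -> dist_set x A = 0 -> A x.
Proof.
move=> cA A0 d0; apply: cA => B /nbhs_ballP[e /= e0 eB].
have [|y Ay xy] := @dist_set_lt x A e A0; first by rewrite d0.
by exists y; split=> //; apply: eB; rewrite ballEmdist.
Qed.

Lemma hausdorff_distC A B : hausdorff_dist A B = hausdorff_dist B A.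
Proof. by rewrite /hausdorff_dist maxC. Qed.

End hausdorff_dist.

Section compact_metric.
Context {R : realType} {X : metricType R}.
Hypothesis cX : compact [set: X].
Implicit Types (A B C : set X) (x y : X).

Lemma compact_mdist_bounded : exists M : R, forall x y : X, mdist x y <= M.
Proof.
have [[a _]|X0] := pselect ([set: X] !=set0); last first.
  by exists 0 => x; case: X0; exists x.
have [[M aM]|nM] := pselect (exists M : R, forall x, mdist a x <= M).
  exists (M + M) => x y; apply: (le_trans (metric_triangle x a y)).
  by apply: lerD => //; rewrite metric_sym.
have H (n : nat) : exists x, n%:R < mdist a x.
  apply: contrapT => /forallNP nx; apply: nM; exists n%:R => x.
  by rewrite leNgt; apply/negP; exact: nx.
have [u hu] := choice H.
have [y [_ yc]] := cX (F := u n @[n --> \oo]) _ filterT.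
pose N := (Num.truncn (mdist a y + 1)).+1.
have [||_ [[n Nn <-]]] := yc [set u n | n in [set n | N <= n]%N] (ball y 1).
- by exists N => // n Nn; exists n.
- exact: nbhsx_ballx.
rewrite ballEmdist /= => yu.
have yN : mdist a y + 1 < N%:R by exact: truncnS_gt.
have Nn' : N%:R <= n%:R :> R by rewrite ler_nat.
have ayu : mdist a (u n) < mdist a y + 1.
  by rewrite (le_lt_trans (metric_triangle a y (u n)))// ltrD2l.
have := lt_le_trans (lt_trans (hu n) (lt_trans ayu yN)) Nn'.
by rewrite ltxx.
Qed.

Lemma dist_set_le_hausdorff A B x : B !=set0 -> A x ->
  dist_set x B <= hausdorff_dist A B.
Proof.
move=> [b Bb] Ax; rewrite /hausdorff_dist le_max; apply/orP; left.
apply: sup_upper_bound; last by exists x.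
split; first by exists (dist_set x B); exists x.
have [M hM] := compact_mdist_bounded.
by exists M => _ [y _ <-]; exact: le_trans (dist_set_le y Bb) (hM _ _).
Qed.

Lemma hausdorff_dist_le A B (e : R) : A !=set0 -> B !=set0 ->
  (forall x, A x -> dist_set x B <= e) ->
  (forall y, B y -> dist_set y A <= e) ->
  hausdorff_dist A B <= e.
Proof.
move=> [a Aa] [b Bb] hA hB; rewrite /hausdorff_dist ge_max.
apply/andP; split; apply: ge_sup.
- by exists (dist_set a B); exists a.
- by move=> _ [x Ax <-]; exact: hA.
- by exists (dist_set b A); exists b.
- by move=> _ [y By <-]; exact: hB.
Qed.

Lemma dist_set_triangle A B C x : A !=set0 -> B !=set0 -> C !=set0 -> A x ->
  dist_set x C <= hausdorff_dist A B + hausdorff_dist B C.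
Proof.
move=> A0 B0 C0 Ax; apply/ler_addgt0Pl => e e0.
have e20 : 0 < e / 2 by rewrite divr_gt0.
have [|y By xy] := @dist_set_lt _ _ x B (hausdorff_dist A B + e / 2) B0.
  apply: le_lt_trans (dist_set_le_hausdorff B0 Ax) _.
  by rewrite ltrDl.
have [|z Cz yz] := @dist_set_lt _ _ y C (hausdorff_dist B C + e / 2) C0.
  apply: le_lt_trans (dist_set_le_hausdorff C0 By) _.
  by rewrite ltrDl.
apply: (le_trans (dist_set_le x Cz)).
apply: (le_trans (metric_triangle x y z)).
apply: (le_trans (lerD (ltW xy) (ltW yz))).
by rewrite addrACA -splitr addrC.
Qed.

Lemma hausdorff_dist_triangle A B C : A !=set0 -> B !=set0 -> C !=set0 ->
  hausdorff_dist A C <= hausdorff_dist A B + hausdorff_dist B C.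
Proof.
move=> A0 B0 C0; apply: hausdorff_dist_le => // x Ax.
  exact: dist_set_triangle.
rewrite addrC (hausdorff_distC A) (hausdorff_distC B).
exact: dist_set_triangle.
Qed.

Lemma hausdorff_distxx A : A !=set0 -> hausdorff_dist A A = 0.
Proof.
move=> A0; apply/eqP; rewrite eq_le; apply/andP; split.
  by apply: hausdorff_dist_le => // x Ax; rewrite -(mdistxx x) dist_set_le.
case: (A0) => a Aa; exact: le_trans (dist_set_ge0 a A) (dist_set_le_hausdorff A0 Aa).
Qed.

Lemma hausdorff_dist_eq0 A B : closed A -> closed B -> A !=set0 -> B !=set0 ->
  hausdorff_dist A B = 0 -> A = B.
Proof.
move=> cA cB A0 B0 AB; apply/seteqP; split=> x hx; apply: dist_set_eq0 => //;
  apply/eqP; rewrite eq_le dist_set_ge0 andbT -AB; last rewrite hausdorff_distC;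
  exact: dist_set_le_hausdorff.
Qed.

Lemma omega_limitE (f : X -> X) x :
  omega_limit f x = cluster (iter n f x @[n --> \oo]).
Proof.
apply/seteqP; split=> y.
  move=> [n [noo ny]] A B [N _ NA] /nbhs_ballP[e /= e0 eB].
  have h1 : \forall i \near \oo, (N <= n i)%N by exact: noo (nbhs_infty_ge N).
  have h2 : \forall i \near \oo, mdist (iter (n i) f x) y < e.
    have := ny; move=> /cvgrPdist_lt /(_ _ e0); apply: filterS => i.
    by rewrite sub0r normrN ger0_norm// mdist_ge0.
  have [i [Ni iy]] := filter_ex (filterI h1 h2).
  exists (iter (n i) f x); split; first exact: NA.
  by apply: eB; rewrite ballEmdist/= metric_sym.
move=> yc.
have H (i : nat) : exists m, (i <= m)%N /\ mdist (iter m f x) y < i.+1%:R^-1.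
  have [||z [[m im <-]] hz] := yc [set iter m f x | m in [set m | i <= m]%N]
    (ball y i.+1%:R^-1).
  - by exists i => // m im; exists m.
  - by apply: nbhsx_ballx; rewrite invr_gt0.
  - by exists m; split=> //; move: hz; rewrite ballEmdist/= metric_sym.
have [n hn] := choice H; exists n; split.
  move=> A [N _ NA]; exists N => // i /= Ni; apply: NA => /=.
  by apply: leq_trans Ni _; have [] := hn i.
apply/cvgrPdist_lt => e e0; near=> i.
rewrite sub0r normrN ger0_norm ?mdist_ge0//.
apply: (lt_trans (hn i).2).
near: i; exact: near_infty_natSinv_lt (PosNum e0).
Unshelve. all: by end_near. Qed.

Lemma omega_limit_nonempty (f : X -> X) x : omega_limit f x !=set0.
Proof.
rewrite omega_limitE.
have [y [_ ?]] := cX (F := iter n f x @[n --> \oo]) _ filterT.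
by exists y.
Qed.

Lemma omega_limit_closed (f : X -> X) x : closed (omega_limit f x).
Proof.
rewrite omega_limitE clusterE.
by apply: closed_bigI => A _; exact: closed_closure.
Qed.

End compact_metric.

Record hyperspace (R : realType) (X : continuumType R) := Hyperspace {
  hyperspace_set :> set X;
  hyperspace_closed : closed hyperspace_set;
  hyperspace_nonempty : hyperspace_set !=set0 }.

HB.instance Definition _ (R : realType) (X : continuumType R) :=
  gen_eqMixin (hyperspace X).
HB.instance Definition _ (R : realType) (X : continuumType R) :=
  gen_choiceMixin (hyperspace X).

Section hyperspace_metric.
Context {R : realType} {X : continuumType R}.
Implicit Types A B C : hyperspace X.

Lemma continuum_compact : compact [set: X].
Proof. by have [] := @continuumT R X. Qed.

Lemma hyperspace_inj A B : A = B :> set X -> A = B.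
Proof.
case: A B => [A cA A0] [B cB B0] /= AB; case: _ / AB in cB B0 *.
by congr Hyperspace; exact: Prop_irrelevance.
Qed.

Definition hyperspace_dist A B : R := hausdorff_dist A B.

Lemma hyperspace_distxx A : hyperspace_dist A A = 0.
Proof. exact: hausdorff_distxx continuum_compact _ (hyperspace_nonempty A). Qed.

Lemma hyperspace_dist_eq0 A B : hyperspace_dist A B = 0 -> A = B.
Proof.
move=> AB; apply: hyperspace_inj.
by apply: (hausdorff_dist_eq0 continuum_compact) => //;
  solve [exact: hyperspace_closed | exact: hyperspace_nonempty].
Qed.

Lemma hyperspace_distC A B : hyperspace_dist A B = hyperspace_dist B A.
Proof. exact: hausdorff_distC. Qed.

Lemma hyperspace_dist_triangle B A C :
  hyperspace_dist A C <= hyperspace_dist A B + hyperspace_dist B C.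
Proof.
by apply: (hausdorff_dist_triangle continuum_compact);
  exact: hyperspace_nonempty.
Qed.

End hyperspace_metric.

HB.instance Definition _ (R : realType) (X : continuumType R) :=
  @isMetric.Build R (hyperspace X) (@hyperspace_dist R X)
    hyperspace_distxx hyperspace_dist_eq0 hyperspace_distC
    hyperspace_dist_triangle.

Definition omega_map (R : realType) (X : continuumType R) (f : X -> X) (x : X)
    : hyperspace X :=
  Hyperspace (@omega_limit_closed R X f x)
    (omega_limit_nonempty continuum_compact f x).

(* Main.v *)
(** If a wandering point [x] has a neighbourhood [U] disjoint from its
    preimages, the sets [f^n(U)] are pairwise disjoint.  For a connected
    neighbourhood [V] of [x] with closure inside [U], the continua
    [f^n(closure V)] are pairwise disjoint, so their diameters tend to [0] by
    hereditary local connectedness; hence all points of [V] are asymptotic to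
    [x], and [omega_f] is constant on [V].

    The diameters tend to [0] because otherwise infinitely many of the disjoint
    continua [K_n] pass near two distinct points [p] and [q].  If [W] is a small
    connected neighbourhood of [p], the closure of the union of [W] and the
    [K_n] meeting it is a continuum in which each of these [K_n] is locally
    clopen near [q], so it is not locally connected at [q]. *)

Require Import Defs.
From mathcomp Require Import all_boot all_order all_algebra.
From mathcomp Require Import all_classical all_reals all_analysis.
From mathcomp Require Import lra.

Import Order.TTheory GRing.Theory Num.Theory.
Import numFieldNormedType.Exports.

Local Open Scope classical_set_scope.
Local Open Scope ring_scope.

Set Implicit Arguments.
Unset Strict Implicit.

(** * Disjoint continua in a hereditarily locally connected space *)

Section null_sequences.
Context {R : realType} {X : continuumType R}.
Implicit Types (O K : nat -> set X).

Lemma hlc_connected_nbhs (p : X) (e : R) :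
  hereditarily_locally_connected X -> 0 < e ->
  exists W : set X, [/\ open W, W p, connected W & closure W `<=` ball p e].
Proof.
move=> hX e0; have e20 : 0 < e / 2 by rewrite divr_gt0.
have [W [oW Wp WU]] := hX setT continuumT p (ball p (e / 2))° I
  (@open_interior _ _) (nbhs_singleton (nbhs_interior (nbhsx_ballx _ _ e20))).
rewrite setIT in WU * => cW; exists W; split=> //.
apply: subset_trans (subset_closure_half e0); rewrite -closure_ballE.
by apply: closure_subset; apply: subset_trans WU _; exact: interior_subset.
Qed.

(** [(p, q)] is a cluster point of the pairs [(x n, y n)] in the compact product, so a single index
    [n] serves both neighbourhoods. *)
Lemma pair_cluster (x y : nat -> X) : exists p q : X, forall (A B : set X) N,
  nbhs p A -> nbhs q B -> exists n, [/\ (N <= n)%N, A (x n) & B (y n)].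
Proof.
have cXX := compact_setX (@continuum_compact R X) (@continuum_compact R X).
have [|[p q] [_ pq]] := cXX ((x n, y n) @[n --> \oo]) _.
  by exists 0%N.
exists p, q => A B N pA qB.
have [||z [[n Nn <-] [/= ? ?]]] := pq [set (x n, y n) | n in [set n | N <= n]%N]
  (A `*` B).
- by exists N => // n Nn; exists n.
- by exists (A, B).
- by exists n.
Qed.

Lemma hlc_null_sequence O K (e : R) : hereditarily_locally_connected X ->
  trivIset setT O -> (forall n, open (O n)) -> (forall n, K n `<=` O n) ->
  (forall n, closed (K n)) -> (forall n, connected (K n)) -> 0 < e ->
  \forall n \near \oo, forall x y, K n x -> K n y -> mdist x y < e.
Proof.
move=> hX tO oO KO clK cK e0; apply: contrapT => nnull.
have H N : exists nxy : nat * X * X, let: (n, x, y) := nxy in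
    [/\ (N <= n)%N, K n x, K n y & e <= mdist x y].
  apply: contrapT => /forallNP h; apply: nnull; exists N => // n /= Nn x y Kx Ky.
  by rewrite ltNge; apply/negP => exy; apply: (h (n, x, y)).
have [n [x [y hz]]] : exists (n : nat -> nat) (x y : nat -> X), forall N,
    [/\ (N <= n N)%N, K (n N) (x N), K (n N) (y N) & e <= mdist (x N) (y N)].
  have [z hz] := choice H.
  exists (fun N => (z N).1.1), (fun N => (z N).1.2), (fun N => (z N).2) => N.
  by have := hz N; case: (z N) => [[]].
have [p [q pq]] := pair_cluster x y.
have e40 : 0 < e / 4 by rewrite divr_gt0.
(* A point common to both balls would give [mdist (x N) (y N) < e] through four distances below
   [e / 4]. *)
have pqe : ball p (e / 4) `&` ball q (e / 4) = set0.
  rewrite -subset0 => u []; rewrite !ballEmdist /= => pu qu.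
  have [N [_]] := pq _ _ 0%N (nbhsx_ballx p _ e40) (nbhsx_ballx q _ e40).
  rewrite !ballEmdist /= => px qy.
  have [_ _ _] := hz N; apply/negP; rewrite -ltNge.
  have := metric_triangle (x N) p (y N); have := metric_triangle p u (y N).
  have := metric_triangle u q (y N).
  by rewrite (metric_sym (x N) p) (metric_sym u q); lra.
have [W [oW Wp cW Wpe]] := hlc_connected_nbhs p hX e40.
have nW : nbhs p W by exact: open_nbhs_nbhs.
pose S := [set n | K n `&` W !=set0].
(* [W] is put into every term so that all terms share [p] and the union is connected. *)
pose Z := \bigcup_(n in S) (W `|` K n).
have KZ m : S m -> K m `<=` closure Z.
  by move=> Sm u Ku; apply: subset_closure; exists m => //; right.
have S0 : S !=set0.
  have [N [_ WN _]] := pq W setT 0%N nW filterT.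
  by exists (n N); exists (x N); split=> //; have [] := hz N.
have Ycont : continuum (closure Z).
  split.
  - case: S0 => m Sm; exists p; apply: subset_closure; exists m => //; by left.
  - apply: connected_closure; apply: bigcup_connected.
      by exists p => m _; left.
    by move=> m [u [Ku Wu]]; apply: connectedU => //; exists u.
  - apply: (subclosed_compact (@closed_closure _ _) (@continuum_compact R X)) => //.
have Yq : closure Z q.
  move=> B qB; have [N [_ WN BN]] := pq W B 0%N nW qB.
  have [_ Kx Ky _] := hz N; exists (y N); split=> //.
  by exists (n N); [exists (x N) | right].
have [V [oV Vq VU cV]] := hX _ Ycont q (ball q (e / 4))° Yq
  (@open_interior _ _) (nbhs_singleton (nbhs_interior (nbhsx_ballx _ _ e40))).
have meetV M : exists m, [/\ (M <= m)%N, S m & K m `&` V !=set0].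
  have [N [MN WN VN]] := pq W V M nW (open_nbhs_nbhs (conj oV Vq)).
  have [Nn Kx Ky _] := hz N; exists (n N); split; first exact: leq_trans Nn.
    by exists (x N).
  by exists (y N).
(* [K m] is clopen in [V `&` closure Z]: near a point of [O m] outside the
   closures of [W] and [K m] there is no point of [Z]. *)
have VK m : S m -> K m `&` V !=set0 -> V `&` closure Z `<=` K m.
  move=> Sm [u [Ku Vu]].
  suff <- : (V `&` closure Z) `&` K m = V `&` closure Z by move=> ? [].
  apply: cV.
  - by exists u; do 2?split=> //; exact: (KZ m).
  - exists (O m) => //; apply/seteqP; split=> v [VZv Kv]; split=> //.
      exact: KO.
    apply: contrapT => nKv.
    have nWv : ~ closure W v.
      move=> /Wpe pv; have /interior_subset qv := VU _ VZv.
      by have : set0 v by rewrite -pqe.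
    have : nbhs v (O m `&` (~` K m `&` ~` closure W)).
      apply: open_nbhs_nbhs; split=> //; apply: openI => //.
      by apply: openI; rewrite openC => //; exact: closed_closure.
    case: VZv => _ Zv /Zv [w [[k Sk [Ww|Kw]] [Ow [nKw nWw]]]].
      by apply: nWw; exact: subset_closure.
    suff mk : m = k by rewrite mk in nKw.
    by apply: (tO m k) => //; exists w; split=> //; exact: KO.
  - by exists (K m).
(* By [VK], [K m] contains the part of [closure Z] in [V], so it meets a later [K k] given by
   [meetV], against disjointness. *)
have [m [_ Sm KVm]] := meetV 0%N.
have [k [mk Sk [u [Ku Vu]]]] := meetV m.+1.
have Kmu : K m u by apply: (VK m) => //; split=> //; exact: (KZ k).
suff E : m = k by rewrite E ltnn in mk.
by apply: (tO m k) => //; exists u; split; exact: KO.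
Qed.

End null_sequences.

Unset Implicit Arguments.

(** * Iterates and orbits near a wandering point *)

Lemma iter_continuous (T : topologicalType) (f : T -> T) n :
  continuous f -> continuous (iter n f).
Proof.
move=> cf; elim: n => [|n IHn] x; first exact: cvg_id.
by apply: (@continuous_comp _ _ _ (iter n f) f); [exact: IHn | exact: cf].
Qed.

Lemma iter_cancel (T : Type) (f g : T -> T) n :
  cancel f g -> cancel (iter n f) (iter n g).
Proof. by move=> fg; elim: n => // n IHn x; rewrite iterSr /= fg. Qed.

(** If [i < j], then [iter (j - i) f] sends [iter j g z] to [iter i g z], so these two points cannot
    both lie in [U]. *)
Lemma preimage_iter_trivIset {T : Type} {f g : T -> T} {U : set T} :
  cancel g f ->
  (forall n, (1 <= n)%N -> (iter n f @^-1` U) `&` U = set0) ->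
  trivIset setT (fun n => iter n g @^-1` U).
Proof.
move=> gf wU.
suff H i j z : (i < j)%N -> U (iter i g z) -> U (iter j g z) -> False.
  move=> i j _ _ [z [Ui Uj]]; case: (ltngtP i j) => // ij.
    by case: (H _ _ _ ij Ui Uj).
  by case: (H _ _ _ ij Uj Ui).
move=> ij Ui Uj; have ji : (1 <= j - i)%N by rewrite subn_gt0.
have : set0 (iter j g z); last by [].
rewrite -(wU _ ji); split=> //=.
by rewrite -[X in iter X g](subnK (ltnW ij)) iterD iter_cancel.
Qed.

(** The times [n i] along which the orbit of [x] approaches [z] serve for [y] too, by the triangle
    inequality. *)
Lemma omega_limit_asymptotic {R : realType} {X : metricType R} {f : X -> X}
    {x y : X} :
  mdist (iter n f x) (iter n f y) @[n --> \oo] --> (0 : R) ->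
  omega_limit f x `<=` omega_limit f y.
Proof.
move=> xy z [n [noo nz]]; exists n; split=> //.
apply: (@squeeze_cvgr _ _ _ _ (cst 0) (fun i => mdist (iter (n i) f x)
  (iter (n i) f y) + mdist (iter (n i) f x) z)).
- by near=> i; rewrite mdist_ge0 (metric_sym (iter (n i) f x)) metric_triangle.
- exact: cvg_cst.
- rewrite -[X in _ --> X]addr0; apply: cvgD => //.
  exact: (cvg_comp _ _ noo xy).
Unshelve. all: by end_near. Qed.

Lemma wandering_near_asymptotic {R : realType} {X : continuumType R}
    {f : X -> X} {x : X} :
  hereditarily_locally_connected X -> homeomorphism f -> wandering f x ->
  \forall y \near x,
    mdist (iter n f x) (iter n f y) @[n --> \oo] --> (0 : R).
Proof.
move=> hX [cf [g [fg gf cg]]] [U0 /nbhs_interior/nbhs_ballP[e /= e0 eU] wU0].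
pose U := U0°; have UU0 : U `<=` U0 by exact: interior_subset.
have wU n : (1 <= n)%N -> (iter n f @^-1` U) `&` U = set0.
  by move=> n1; rewrite -subset0 -(wU0 n n1) => z [? ?]; split; exact: UU0.
have [V [oV Vx cV VU]] := hlc_connected_nbhs x hX e0.
(* Closedness is read off from the preimage under [g], connectedness from the image under [f]. *)
have imE n : iter n g @^-1` closure V = iter n f @` closure V.
  apply/seteqP; split=> [z Vz|_ [z Vz <-]].
    by exists (iter n g z) => //; exact: iter_cancel.
  by rewrite /preimage /= iter_cancel.
have null (d : R) : 0 < d -> \forall n \near \oo, forall u v,
    [set iter n f z | z in closure V] u ->
    [set iter n f z | z in closure V] v -> mdist u v < d.
  move=> d0; apply: (@hlc_null_sequence _ _ (fun n => iter n g @^-1` U)) => //.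
  - exact: preimage_iter_trivIset wU.
  - move=> n; move/continuousP: (iter_continuous _ _ n cg); apply.
    exact: open_interior.
  - by move=> n; rewrite -imE => z /VU/eU.
  - move=> n; rewrite -imE.
    move/continuous_closedP: (iter_continuous _ _ n cg); apply.
    exact: closed_closure.
  - move=> n; apply: connected_continuous_connected.
      exact: connected_closure.
    by apply: continuous_subspaceT; exact: iter_continuous.
have nV : nbhs x V by exact: open_nbhs_nbhs.
apply: filterS nV => y Vy; apply/cvgrPdist_lt => d d0.
apply: filterS (null d d0) => n; rewrite sub0r normrN ger0_norm ?mdist_ge0//.
by apply; [exists x | exists y] => //; exact: subset_closure.
Qed.

Theorem corollary3p11 (R : realType) (X : continuumType R) (f : X -> X)
    (hX : hereditarily_locally_connected X) (hf : homeomorphism f) :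
  {in ~` nonwandering_set f, continuous (omega_map f)}.
Proof.
move=> x; rewrite inE /= => /contrapT wx.
(* It suffices that [omega_map f] is constant near [x]; symmetry of the distance yields both
   inclusions. *)
apply: cvg_near_cst.
apply: filterS (wandering_near_asymptotic hX hf wx) => y xy.
apply: hyperspace_inj; apply/seteqP; split; apply: omega_limit_asymptotic => //.
by under eq_fun do rewrite metric_sym.
Qed.
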